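(* Let $d\ge 1$. Every nontrivial block gluing $\mathbb{Z}^d$-shift of finite type has topologically completely positive entropy (TCPE).
   Context: For a finite set $A$ (an alphabet), $A^{\mathbb{Z}^d}$ carries the product of discrete topologies and the shift action $(\sigma_t x)(s)=x(s+t)$, $s,t\in\mathbb{Z}^d$. A $\mathbb{Z}^d$-subshift is a nonempty closed shift-invariant subset of some $A^{\mathbb{Z}^d}$, regarded as a topological dynamical system under $\sigma$. A pattern with shape $S$ is an element of $A^S$ for a finite $S\subset\mathbb{Z}^d$; $x(S)$ is the restriction of $x$ to $S$; patterns are identified up to translation when speaking of their appearing in a point. A $\mathbb{Z}^d$-shift of finite type (SFT) is a (nonempty) subshift consisting of all $x\in A^{\mathbb{Z}^d}$ in which no pattern from some fixed finite set of patterns appears. $L(X)$ is the set of patterns appearing in points of $X$, and $L_S(X)=L(X)\cap A^S$. A $\mathbb{Z}^d$-subshift $X$ is block gluing if there exists $g\in\mathbb{N}$ such that for any two boxes $S=\prod_{i=1}^d\{a_i,\ldots,b_i\}$ and $S'=\prod_{i=1}^d\{a'_i,\ldots,b'_i\}$ in $\mathbb{Z}^d$ with $\min_{s\in S,\,s'\in S'}\|s-s'\|_\infty> g$, and any $w\in L_S(X)$, $w'\in L_{S'}(X)$, there is $x\in X$ with $x(S)=w$ and $x(S')=w'$. A system is nontrivial if it contains more than one point. A $\mathbb{Z}^d$ topological dynamical system $(X,T_v)$ is a compact metric space $X$ with a $\mathbb{Z}^d$-action $\{T_v\}_{v\in\mathbb{Z}^d}$ by homeomorphisms. Its topological entropy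 is $h(X,T_v)=\sup_{\mathcal{U}}\lim_{n\to\infty}\frac1{n^d}\log N\left(\bigvee_{v\in\{1,\ldots,n\}^d} T_v\mathcal{U}\right)$, where $\mathcal{U}$ ranges over open covers of $X$ and $N(\cdot)$ is the minimal cardinality of a subcover. A factor map $(X,T_v)\to(Y,S_v)$ is a continuous map $\phi:X\to Y$ with $\phi\circ T_v=S_v\circ\phi$ for all $v$. $(X,T_v)$ has TCPE if for every surjective factor map from $(X,T_v)$ to a $\mathbb{Z}^d$ topological dynamical system $(Y,S_v)$, either $h(Y,S_v)>0$ or $|Y|=1$. *)

(* Defs.v *)
From HB Require Import structures.
From mathcomp Require Import all_boot all_order all_algebra finmap.
From mathcomp Require Import all_classical all_reals all_analysis.

Set Implicit Arguments.
Unset Strict Implicit.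
Unset Printing Implicit Defensive.

Import Order.TTheory GRing.Theory Num.Theory.
Import numFieldNormedType.Exports.

Local Open Scope classical_set_scope.
Local Open Scope ring_scope.

Notation Zd d := {ffun 'I_d -> int}.

Definition supnorm d (s : Zd d) : nat := (\max_(i < d) `|s i|)%N.

(* A predicate on topologies rather than a [metricType] structure, since the
   latter also fixes the balls; the carrier of a subshift then keeps the
   subtype topology of [set_type]. *)
Definition metrizable (R : realType) (T : topologicalType) : Prop :=
  exists dist : T -> T -> R,
    [/\ forall x, dist x x = 0,
        forall x y, dist x y = 0 -> x = y,
        forall x y, dist x y = dist y x,
        forall x y z, dist x z <= dist x y + dist y z
      & forall x, nbhs x =
          filter_from [set e : R | 0 < e] (fun e => [set y | dist x y < e])].

(* [act0] and [actD] make every [act v] invertible with inverse [act (- v)],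
   so that, with [act_continuous], each [act v] is a homeomorphism. *)
Record system (R : realType) (d : nat) := System {
  carrier :> topologicalType;
  sys_compact : compact [set: carrier];
  sys_metrizable : metrizable R carrier;
  act : Zd d -> carrier -> carrier;
  act0 : forall x, act 0 x = x;
  actD : forall u v x, act (u + v) x = act u (act v x);
  act_continuous : forall v, continuous (act v)
}.

Definition open_cover (T : topologicalType) (U : set (set T)) : Prop :=
  (forall B, U B -> open B) /\ \bigcup_(B in U) B = [set: T].

Definition has_subcover_of_card T (U : set (set T)) (k : nat) : Prop :=
  exists V : set (set T),
    [/\ V `<=` U, \bigcup_(B in V) B = [set: T] & (V #= `I_k)%card].

(* The value 0 is returned if [U] has no finite subcover, which does not happen
   for open covers of compact spaces. *)
Definition min_subcover T (U : set (set T)) : nat :=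
  xget 0%N [set k | has_subcover_of_card U k /\
                    forall j, has_subcover_of_card U j -> (k <= j)%N].

Definition cube d (n : nat) : set (Zd d) :=
  [set v : Zd d | forall i, 1 <= v i <= n%:Z].

Definition join_cover R d (X : system R d) (U : set (set X)) (n : nat) :
    set (set X) :=
  [set B | exists2 f : Zd d -> set X,
     (forall v, cube n v -> U (f v)) &
     B = \bigcap_(v in cube n) (act v @` f v)].

(* The limit exists for open covers by subadditivity of the logarithm of
   [min_subcover]. *)
Definition cover_entropy R d (X : system R d) (U : set (set X)) : R :=
  limn (fun n => ln (min_subcover (join_cover U n))%:R / n%:R ^+ d : R).

Definition entropy R d (X : system R d) : \bar R :=
  ereal_sup [set (cover_entropy U)%:E | U in @open_cover X].

Definition factor_map R d (X Y : system R d) (phi : X -> Y) : Prop :=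
  continuous phi /\ forall v x, phi (act v x) = act v (phi x).

Definition TCPE R d (X : system R d) : Prop :=
  forall (Y : system R d) (phi : X -> Y),
    factor_map phi -> (forall y, exists x, phi x = y) ->
    (0 < entropy Y)%E \/ exists y0 : Y, forall y, y = y0.

Definition config (d : nat) (A : finType) : topologicalType :=
  prod_topology (fun _ : Zd d => discrete_topology A).

Definition Zshift d (A : finType) (t : Zd d) (x : config d A) : config d A :=
  fun s => x (s + t).

Record subshift (d : nat) (A : finType) := Subshift {
  points :> set (config d A);
  points_nonempty : points !=set0;
  points_closed : closed points;
  points_shift : forall t x, points x -> points (Zshift t x)
}.

(* The shape of a pattern [w] is [domf w]; translation is accounted for in
   [appears]. *)
Definition pattern (d : nat) (A : finType) : Type := {fmap Zd d -> A}.

HB.instance Definition _ d (A : finType) :=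
  Choice.copy (pattern d A) {fmap Zd d -> A}.

Definition restriction d (A : finType) (x : config d A) (S : {fset Zd d}) :
    pattern d A :=
  [fmap s : S => (x (val s) : A)]%fmap.

Definition appears d (A : finType) (w : pattern d A) (x : config d A) : Prop :=
  exists t, restriction (Zshift t x) (domf w) = w.

Definition language d (A : finType) (X : set (config d A)) :
    set (pattern d A) :=
  [set w | exists2 x, X x & appears w x].

Definition language_on d (A : finType) (X : set (config d A))
    (S : {fset Zd d}) : set (pattern d A) :=
  [set w | language X w /\ domf w = S].

Definition SFT d (A : finType) (X : subshift d A) : Prop :=
  exists F : {fset pattern d A},
    points X = [set x | forall w, w \in F -> ~ appears w x].

Definition is_box d (S : {fset Zd d}) : Prop :=
  exists a b : Zd d, (forall i, a i <= b i) /\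
    forall s, (s \in S) = [forall i, a i <= s i <= b i].

(* As boxes are finite and nonempty, the third premise says that the minimal
   distance between [S] and [S'] exceeds [g]. *)
Definition block_gluing d (A : finType) (X : subshift d A) : Prop :=
  exists g : nat, forall S S' : {fset Zd d}, is_box S -> is_box S' ->
    (forall s s', s \in S -> s' \in S' -> (g < supnorm (s - s')%R)%N) ->
    forall w w', language_on X S w -> language_on X S' w' ->
      exists x, [/\ points X x, restriction x S = w & restriction x S' = w'].

Definition nontrivial d (A : finType) (X : subshift d A) : Prop :=
  exists x y, [/\ points X x, points X y & x <> y].

Section SubshiftSystem.
Context (R : realType) (d : nat) (A : finType) (X : subshift d A).

Let agree (n : nat) (x y : config d A) :=
  forall s : Zd d, (choice.pickle s < n)%N -> x s = y s.

Let dset x y : set R := [set n.+1%:R^-1 | n in [set n | agree n x y]].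

Let dist (x y : config d A) : R := inf (dset x y).

Let dset_lb x y : has_lbound (dset x y).
Proof. by exists 0 => _ [n _ <-]; rewrite invr_ge0 ler0n. Qed.

Let dset_inf x y : has_inf (dset x y).
Proof. by split=> //; exists 1, 0%N => //; rewrite invr1. Qed.

Let dist_ltP x y e :
  dist x y < e <-> exists2 n, n.+1%:R^-1 < e & agree n x y.
Proof.
split=> [lte|[n ne agn]].
  have [_ [n agn <-] ne] := inf_lt (dset_inf x y).1 lte.
  by exists n.
by apply: le_lt_trans ne; apply: ge_inf => //; exists n.
Qed.

Let dist_ge0 x y : 0 <= dist x y.
Proof.
apply: lb_le_inf; first by case: (dset_inf x y).
by move=> _ [n _ <-]; rewrite invr_ge0 ler0n.
Qed.

Let small (e : R) : 0 < e -> exists n : nat, n.+1%:R^-1 < e.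
Proof.
move=> e0; exists (Num.truncn e^-1).
rewrite invf_plt ?posrE ?ltr0n//.
exact: truncnS_gt.
Qed.

Let distxx x : dist x x = 0.
Proof.
apply/eqP; rewrite eq_le dist_ge0 andbT leNgt; apply/negP => /small[n nlt].
have : dist x x < dist x x by apply/dist_ltP; exists n.
by rewrite ltxx.
Qed.

Let dist_agree n x y : dist x y < n.+1%:R^-1 -> agree n x y.
Proof.
move=> /dist_ltP[m]; rewrite ltf_pV2 ?posrE ?ltr0n// ltr_nat ltnS => nm + s sn.
by apply; rewrite (ltn_trans sn).
Qed.

Let dist_eq0 x y : dist x y = 0 -> x = y.
Proof.
move=> d0; apply/funext => s; apply: (@dist_agree (choice.pickle s).+1) => //.
by rewrite d0 invr_gt0 ltr0n.
Qed.

Let dist_sym x y : dist x y = dist y x.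
Proof.
congr inf; apply/seteqP; split=> _ [n agn <-]; exists n => // s sn;
  by rewrite agn.
Qed.

Let dist_triangle x y z : dist x z <= dist x y + dist y z.
Proof.
apply/ler_addgt0Pl => e e0; apply: ltW.
have e2 : 0 < e / 2 by rewrite divr_gt0.
have /dist_ltP[n ne agn] : dist x y < dist x y + e / 2 by rewrite ltrDl.
have /dist_ltP[m me agm] : dist y z < dist y z + e / 2 by rewrite ltrDl.
rewrite {1}(splitr e) addrACA [e / 2 + _]addrC [e / 2 + _]addrC.
apply/dist_ltP; exists (minn n m).
  case: (leqP n m) => _.
    by rewrite (lt_le_trans ne)// lerDl addr_ge0// ltW.
  by rewrite (lt_le_trans me)// lerDr addr_ge0// ltW.
by move=> s; rewrite leq_min => /andP[sn sm]; rewrite agn// agm.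
Qed.

Let coord_nbhs (x : config d A) s : nbhs x [set y | y s = x s].
Proof.
have := @proj_continuous _ (fun _ : Zd d => discrete_topology A) s x.
by move=> /(_ [set x s]); apply; exact: discrete_set1.
Qed.

Let agree_nbhs n (x : config d A) : nbhs x [set y | agree n x y].
Proof.
elim: n => [|n IHn]; first by apply: filterE => y s; rewrite ltn0.
have xn : nbhs x [set y | forall s : Zd d, choice.pickle s = n -> x s = y s].
  have [[s sn]|nos] := pselect (exists s : Zd d, choice.pickle s = n).
    apply: filterS (coord_nbhs x s) => y ys t tn.
    by have -> : t = s by apply: (pcan_inj choice.pickleK); rewrite tn sn.
  by apply: filterE => y s sn; case: nos; exists s.
apply: filterS2 IHn xn => y yn ys s; rewrite ltnS leq_eqVlt => /orP[/eqP|].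
  exact: ys.
exact: yn.
Qed.

Let nbhs_dist (x : config d A) :
  nbhs x = filter_from [set e : R | 0 < e] (fun e => [set y | dist x y < e]).
Proof.
apply/seteqP; split=> [|B [e /= /small[n ne] eB]]; last first.
  apply: filterS (agree_nbhs n x) => y agn; apply: eB => /=.
  by apply/dist_ltP; exists n.
set F := filter_from _ _.
have FF : Filter F.
  apply: filter_from_filter; first by exists 1 => /=.
  move=> i j /= i0 j0; exists (Num.min i j); first by rewrite /= lt_min i0.
  by move=> y /=; rewrite lt_min => /andP[].
change (F --> (x : prod_topology (fun _ : Zd d => discrete_topology A))).
apply/cvg_sup => s B [V [[W oW <-] Wx VB]].
exists (choice.pickle s).+2%:R^-1; first by rewrite /= invr_gt0 ltr0n.
move=> y /= /dist_agree agy; apply: VB => /=.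
by move: Wx => /=; rewrite -(agy s).
Qed.

Lemma subshift_metrizable : metrizable R (set_type X).
Proof.
exists (fun x y => dist (set_val x) (set_val y)); split.
- by move=> x; exact: distxx.
- by move=> x y /dist_eq0 xy; exact/val_inj.
- by move=> x y; exact: dist_sym.
- by move=> x y z; exact: dist_triangle.
move=> x; apply/seteqP; split=> [B|B [e /= e0 eB]].
  rewrite nbhsE => -[_ [[W oW <-] Wx] WB].
  have : nbhs (set_val x : config d A) W by apply: open_nbhs_nbhs.
  rewrite nbhs_dist => -[e e0 eW]; exists e => // y /= ye.
  exact/WB/eW.
have nV : nbhs (set_val x) [set y : config d A | dist (set_val x) y < e].
  rewrite nbhs_dist; exists e => //.
have nx := @initial_continuous _ _ (set_val : set_type X -> config d A) x _ nV.
by apply: (@filterS _ (nbhs x) _ _ _ _ nx) => y /= ye; exact: eB.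
Qed.

Lemma subshift_compact : compact [set: set_type X].
Proof.
have cX : compact (points X).
  apply: (@subclosed_compact _ _ [set: config d A]) => //.
    exact: points_closed.
  have cA : compact [set: discrete_topology A].
    by apply: finite_compact; exact: (@finite_finset A).
  have := @tychonoff _ (fun _ : Zd d => discrete_topology A) _ (fun=> cA).
  by congr compact; apply/seteqP; split.
move=> F FF _.
pose G : set_system (config d A) := fmap (set_val : set_type X -> _) F.
have GF : ProperFilter G by exact: fmap_proper_filter.
have [x [Xx cx]] : points X `&` cluster G !=set0.
  apply: cX.
  by rewrite /G /fmap /=; apply: (@filterE _ F) => y; exact: set_valP.
exists (exist _ x (mem_set Xx)); split=> // B V FB.
rewrite nbhsE => -[_ [[W oW <-] Wx] WV].
have Fimg : G (set_val @` B).
  by apply: (@filterS _ F _ B) => // y By; exists y.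
have nW : nbhs x W by apply: open_nbhs_nbhs.
have [_ [[y By <-] Wy]] := cx _ _ Fimg nW.
by exists y; split=> //; exact: WV.
Qed.

Definition subshift_act (t : Zd d) (x : set_type X) : set_type X :=
  exist _ (Zshift t (set_val x)) (mem_set (points_shift t (set_valP x))).

Lemma subshift_act0 x : subshift_act 0 x = x.
Proof. by apply: val_inj; apply/funext => s; rewrite /= /Zshift addr0. Qed.

Lemma subshift_actD u v x :
  subshift_act (u + v) x = subshift_act u (subshift_act v x).
Proof.
by apply: val_inj; apply/funext => s; rewrite /= /Zshift addrA.
Qed.

Lemma subshift_act_continuous v : continuous (subshift_act v).
Proof.
move=> x B; rewrite nbhsE => -[_ [[W oW <-] Wx] WB].
have nW : nbhs (Zshift v (set_val x)) W by apply: open_nbhs_nbhs.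
have shift_cvg : Zshift v @ nbhs (set_val x) --> Zshift v (set_val x).
  apply/cvg_sup => s C [D [[E oE <-] Ex DC]].
  have nE : nbhs (set_val x) [set y | y (s + v) = set_val x (s + v)].
    exact: coord_nbhs.
  by apply: filterS nE => y ys; apply: DC; rewrite /= /Zshift ys.
have nx := @initial_continuous _ _ (set_val : set_type X -> config d A) x _
  (shift_cvg _ nW).
by apply: (@filterS _ (nbhs x) _ _ _ _ nx) => y Wy; exact: WB.
Qed.

Definition subshift_system : system R d :=
  System subshift_compact subshift_metrizable subshift_act0 subshift_actD
    subshift_act_continuous.

End SubshiftSystem.

(* Main.v *)
Require Import Defs.
From mathcomp Require Import all_boot all_order all_algebra finmap.
From mathcomp Require Import all_classical all_reals all_analysis.
From mathcomp Require Import zify lra ring.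

(** Block gluing is stated for two boxes only, but the smallest box containing two
boxes carries again a pattern of the subshift, so gluing can be iterated: blocks
are glued into rows, rows into slabs, and so on.  In this way, for some spacing
[p] depending only on the side of the blocks, arbitrary blocks of that side can
be put simultaneously at all points of a box of the sublattice [p Z^d]
([lattice_gluing]).  Any two nonempty open sets of the subshift are therefore
independent along [p Z^d]: an orbit can visit them according to any prescribed
binary array ([lattice_independent]).

Independence descends to factors.  If a factor [Y] has two points, they have
disjoint closed neighbourhoods [V0] and [V1]; the preimages of these contain
cylinders, so [V0] and [V1] are independent along some [p Z^d].  The complements
of [V0] and [V1] form an open cover no element of which meets both [V0] and
[V1], so points realizing different binary arrays lie in different elements of
the joined cover.  Hence the joined cover over a cube of side [q p] has no
subcover with fewer than [2 ^ (q ^ d)] elements, and the entropy of [Y] is at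
least [ln 2 / p ^ d].

The entropy of a cover is a limit, about which the lower bound says something
only once convergence is known.  This follows by Fekete's argument
([subadditive_cvg]) from the submultiplicativity of the minimal cardinality
under tiling a cube by smaller cubes ([min_subcover_cubeM]). *)

Set Implicit Arguments.
Unset Strict Implicit.
Unset Printing Implicit Defensive.

Import Order.TTheory GRing.Theory Num.Theory.
Import numFieldNormedType.Exports.

Local Open Scope classical_set_scope.
Local Open Scope ring_scope.

(** * Minimal subcovers of joined covers *)

Section JointSubcover.
Context (R : realType) (d : nat) (Y : system R d) (U : set (set Y)).

(** A subcover of the join of the translates of [U] over [S], given by
names: a name is a choice of an element of [U] at each site of [S], and two names
may define the same set.  Minimal cardinalities are unaffected, while restricting
[S] and combining several translates of [S] become operations on names. *)
Definition joint_subcover (S : set (Zd d)) (k : nat) : Prop :=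
  exists F : 'I_k -> Zd d -> set Y,
    (forall i v, S v -> U (F i v)) /\
    forall y, exists i, forall v, S v -> F i v (act (- v) y).

Lemma joint_subcover_finType (I : finType) (F : I -> Zd d -> set Y) S :
  (forall i v, S v -> U (F i v)) ->
  (forall y, exists i, forall v, S v -> F i v (act (- v) y)) ->
  joint_subcover S #|I|.
Proof.
move=> UF cF; exists (fun i => F (enum_val i)); split=> [i v|y].
  exact: UF.
by have [i Fi] := cF y; exists (enum_rank i); rewrite enum_rankK.
Qed.

Lemma joint_subcoverS S T k :
  S `<=` T -> joint_subcover T k -> joint_subcover S k.
Proof.
move=> ST [F [UF cF]]; exists F; split=> [i v /ST|y]; first exact: UF.
by have [i Fi] := cF y; exists i => v /ST; exact: Fi.
Qed.

(** A name over a union of [#|J|] translates of [S] is a [J]-tuple of names over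
[S], the [j]-th of which covers the point moved by [- t j]. *)
Lemma joint_subcover_translates (J : finType) (t : J -> Zd d) S k :
  joint_subcover S k ->
  joint_subcover [set v | exists j, S (v - t j)] (k ^ #|J|).
Proof.
move=> [F [UF cF]].
(* A site may lie in several translates; any of them can be used to name it. *)
pose pick_translate (v : Zd d) := [pick j | `[< S (v - t j) >]].
pose G (g : {ffun J -> 'I_k}) v : set Y :=
  if pick_translate v is Some j then F (g j) (v - t j) else set0.
rewrite -[X in (X ^ _)%N]card_ord -card_ffun.
apply: (@joint_subcover_finType _ G) => [g v [j Sj]|y].
  rewrite /G /pick_translate; case: pickP => [i /asboolP Si|/(_ j)/asboolP//].
  exact: UF.
have [g Fg] := choice (fun j => cF (act (- t j) y)).
exists [ffun j => g j] => v [j Sj].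
rewrite /G /pick_translate; case: pickP => [i /asboolP Si|/(_ j)/asboolP//].
by have := Fg i _ Si; rewrite -actD ffunE opprB addrAC subrr add0r.
Qed.

Lemma act_imageP v (B : set Y) y : (act v @` B) y <-> B (act (- v) y).
Proof.
split=> [[z Bz <-]|By]; first by rewrite -actD addNr act0.
by exists (act (- v) y) => //; rewrite -actD subrr act0.
Qed.

Lemma join_cover_joint n k :
  has_subcover_of_card (join_cover U n) k -> joint_subcover (@cube d n) k.
Proof.
move=> [V [VU cV Vk]].
have [h [hV _ hsurj]] : exists h, set_bij `I_k V h.
  by apply/card_set_bijP; rewrite card_eq_sym.
have Vh (i : 'I_k) : V (h i) by apply: hV => /=.
have [F FU] := choice (fun i : 'I_k =>
  let: ex_intro2 f Uf hf := VU _ (Vh i) in ex_intro _ f (conj Uf hf)).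
exists F; split=> [i v|y]; first by have [+ _] := FU i; exact.
have : (\bigcup_(B in V) B) y by rewrite cV.
move=> [B /hsurj[i /= ik <-] hy]; exists (Ordinal ik) => v nv.
have [_ hE] := FU (Ordinal ik); move: hy; rewrite hE => /(_ v nv).
by rewrite act_imageP.
Qed.

Lemma joint_join_cover n k :
  joint_subcover (@cube d n) k ->
  exists2 j, (j <= k)%N & has_subcover_of_card (join_cover U n) j.
Proof.
move=> [F [UF cF]].
pose h (i : nat) :=
  if insub i is Some j then \bigcap_(v in @cube d n) (act v @` F j v) else set0.
have hk : (h @` `I_k #<= `I_k)%card := card_image_le _ _.
have /finite_setP[j hj] : finite_set (h @` `I_k).
  by apply/finite_set_leP; exists k.
exists j; first by rewrite -card_le_II -(card_le_eql hj).
exists (h @` `I_k); split=> //.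
  move=> _ [i /= ik <-]; rewrite /h insubT.
  by exists (F (Ordinal ik)) => // v; exact: UF.
apply/seteqP; split=> // y _; have [i Fi] := cF y.
exists (h i); first by exists i => /=.
by rewrite /h valK => v nv; apply/act_imageP/Fi.
Qed.



Lemma joint_subcover_cube1 k :
  has_subcover_of_card U k -> joint_subcover (@cube d 1) k.
Proof.
move=> [V [VU cV Vk]].
have [h [hV _ hsurj]] : exists h, set_bij `I_k V h.
  by apply/card_set_bijP; rewrite card_eq_sym.
exists (fun i _ => h i); split=> [i v _|y]; first exact/VU/hV/ltn_ord.
pose one : Zd d := [ffun=> 1].
have : (\bigcup_(B in V) B) (act (- one) y) by rewrite cV.
move=> [B /hsurj[i /= ik <-] hy]; exists (Ordinal ik) => v v1.
suff -> : v = one by [].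
apply/ffunP => j; rewrite ffunE; apply/eqP; rewrite eq_le andbC; exact: v1.
Qed.

(** The cube of side [q * m] is tiled by [q ^ d] translates of the cube of side
[m]; the tile of [v] is found by dividing the coordinates of [v - 1] by [m]. *)
Lemma joint_subcover_cubeM q m k : (0 < m)%N ->
  joint_subcover (@cube d m) k ->
  joint_subcover (@cube d (q * m)) (k ^ (q ^ d)).
Proof.
move=> m0 /(@joint_subcover_translates {ffun 'I_d -> 'I_q}
  (fun j => [ffun i => (j i * m)%N%:Z])).
rewrite card_ffun !card_ord; apply: joint_subcoverS => v qv.
have vq i : (`|v i - 1| %/ m < q)%N.
  by rewrite ltn_divLR//; have := qv i; move: (v i) => z; lia.
exists [ffun i => Ordinal (vq i)] => i; rewrite !ffunE /=.
have := qv i; have := divn_eq `|v i - 1| m; have := ltn_pmod `|v i - 1| m0.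
by move: (v i) => z; lia.
Qed.

Hypothesis finU : exists k, has_subcover_of_card U k.

Lemma ex_joint_subcover n : exists k, joint_subcover (@cube d n) k.
Proof.
have [k /joint_subcover_cube1 kU] := finU; exists (k ^ (n ^ d))%N.
by have := joint_subcover_cubeM n (ltn0Sn 0) kU; rewrite muln1.
Qed.

(** The default value in the definition of [min_subcover] is not taken, and the
minimum can be computed with names. *)
Lemma min_subcover_spec n :
  joint_subcover (@cube d n) (min_subcover (join_cover U n)) /\
  forall k, joint_subcover (@cube d n) k ->
    (min_subcover (join_cover U n) <= k)%N.
Proof.
have [k0 /joint_join_cover[j0 _ Jj0]] := ex_joint_subcover n.
have [] : [set k | has_subcover_of_card (join_cover U n) k /\
    forall j, has_subcover_of_card (join_cover U n) j -> (k <= j)%N]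
    (min_subcover (join_cover U n)).
  apply: xgetPex.
  have /ex_minnP[m /asboolP mU mmin] :
      exists k, `[< has_subcover_of_card (join_cover U n) k >].
    by exists j0; exact/asboolP.
  by exists m; split=> // j /asboolP; exact: mmin.
move=> /join_cover_joint mU mmin; split=> // k /joint_join_cover[j jk /mmin].
by move=> /leq_trans; apply.
Qed.

Lemma min_subcover_gt0 n : inhabited Y -> (0 < min_subcover (join_cover U n))%N.
Proof.
by move=> [y]; have [[F [_ /(_ y)[[i ik] _]]] _] := min_subcover_spec n; lia.
Qed.

Lemma min_subcover_cube_homo n m : (n <= m)%N ->
  (min_subcover (join_cover U n) <= min_subcover (join_cover U m))%N.
Proof.
move=> nm; apply: (min_subcover_spec n).2.
apply: joint_subcoverS (min_subcover_spec m).1 => v nv i.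
by have := nv i; move: (v i) => z; lia.
Qed.

Lemma min_subcover_cubeM q m : (0 < m)%N ->
  (min_subcover (join_cover U (q * m)) <=
   min_subcover (join_cover U m) ^ (q ^ d))%N.
Proof.
by move=> m0; apply: (min_subcover_spec _).2; apply: joint_subcover_cubeM;
  [|exact: (min_subcover_spec m).1].
Qed.

End JointSubcover.

(** * Convergence of the entropy of a cover *)

(** Fekete's lemma in dimension [d], for cubes.  Rounding [n] up to a multiple of
[m] gives [a n / n ^ d <= (a m / m ^ d) (1 + m / n) ^ d], so the limit is the
infimum of the [a m / m ^ d]. *)
Lemma subadditive_cvg (R : realType) (d : nat) (a : nat -> R) :
  (forall n, 0 <= a n) -> (forall n m, (n <= m)%N -> a n <= a m) ->
  (forall q m, (0 < m)%N -> a (q * m)%N <= a m * q%:R ^+ d) ->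
  cvgn (fun n => a n / n%:R ^+ d).
Proof.
move=> a0 amono asub; set u := fun n => _.
pose S := [set u m | m in [set m | (0 < m)%N]].
have Sinf : has_inf S.
  split; first by exists (u 1%N), 1%N.
  by exists 0 => _ [m _ <-]; rewrite divr_ge0// exprn_ge0.
apply/cvg_ex; exists (inf S); rewrite -cvg_shiftS; apply/cvgrPdist_lt => e e0.
have [_ [m /= m0 <-] um] : exists2 y, S y & y < inf S + e.
  by apply: inf_lt Sinf.1 _; rewrite ltrDl.
have mR : 0 < m%:R :> R by rewrite ltr0n.
have bound n : (0 < n)%N -> u n <= u m * (1 + m%:R / n%:R) ^+ d.
  move=> n0; have nR : 0 < n%:R :> R by rewrite ltr0n.
  rewrite /u ler_pdivrMr ?exprn_gt0//.
  have nq : (n <= (n %/ m).+1 * m)%N by rewrite ltnW// ltn_ceil.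
  apply: le_trans (amono _ _ nq) _; apply: le_trans (asub _ _ m0) _.
  rewrite -!mulrA ler_wpM2l//.
  rewrite -exprVn -!exprMn.
  apply: lerXn2r; rewrite ?nnegrE ?mulr_ge0 ?addr_ge0 ?invr_ge0 ?ler0n//.
  have -> : m%:R^-1 * ((1 + m%:R / n%:R) * n%:R) = n%:R / m%:R + 1 :> R.
    by field; rewrite !gt_eqF.
  rewrite -natr1 lerD2r ler_pdivlMr// -natrM ler_nat.
  exact: leq_trunc_div.
have lim_bound :
    (u m * (1 + m%:R * harmonic n) ^+ d) @[n --> \oo] -->
    u m * (1 + m%:R * 0) ^+ d.
  apply: cvgM; first exact: cvg_cst.
  apply: (cvg_comp _ (fun x : R => x ^+ d)); last exact: exprn_continuous.
  apply: cvgD; first exact: cvg_cst.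
  by apply: cvgM; [exact: cvg_cst|exact: cvg_harmonic].
rewrite mulr0 addr0 expr1n mulr1 in lim_bound.
have near_lt := cvgr_lt _ lim_bound _ um.
near=> n.
have low : inf S <= u n.+1 by apply: ge_inf Sinf.2 _ _; exists n.+1.
rewrite distrC ger0_norm ?subr_ge0// ltrBlDl.
apply: le_lt_trans (bound _ _) _; first by [].
by near: n; exact: near_lt.
Unshelve. all: by end_near.
Qed.

(** * Independence along a lattice gives positive entropy *)

Section Independence.
Context (R : realType) (d : nat) (Y : system R d).

(** Orbits can visit [A true] and [A false] along [p Z^d] in any prescribed
order.  The sign matches the join [\bigcap_v (act v @` f v)] of a cover: a point
lies in [act v @` B] when [act (- v)] sends it into [B]. *)
Definition lattice_independent (A : bool -> set Y) (p : nat) : Prop :=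
  forall n (F : Zd d -> bool), exists y, forall j, cube n j ->
    A (F j) (act (- (j *+ p)) y).

Variables (A : bool -> set Y) (p : nat) (U : set (set Y)).
Hypotheses (p_gt0 : (0 < p)%N) (indA : lattice_independent A p).
Hypothesis sepU : forall B y z, U B -> A true y -> A false z -> ~ (B y /\ B z).
Hypothesis finU : exists k, has_subcover_of_card U k.

(** Points realizing distinct arrays differ at a site where one is in [A true] and
the other in [A false], so they cannot share a name. *)
Lemma joint_subcover_independent q k :
  joint_subcover U (@cube d (q * p)) k -> (2 ^ (q ^ d) <= k)%N.
Proof.
move=> [G [UG cG]].
pose site (j : {ffun 'I_d -> 'I_q}) : Zd d := [ffun i => (j i).+1%:Z].
have site_inj : injective site.
  move=> j j' /ffunP jj'; apply/ffunP => i; apply/val_inj.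
  by have := jj' i; rewrite !ffunE => -[].
have siteq j : cube q (site j).
  by move=> i; rewrite ffunE; have := ltn_ord (j i); lia.
have siteqp j : cube (q * p) (site j *+ p).
  move=> i; rewrite ffunMnE ffunE -mulr_natr natz.
  have := ltn_ord (j i); nia.
have codeP (F : {ffun {ffun 'I_d -> 'I_q} -> bool}) : exists i, exists y,
    forall j, A (F j) (act (- (site j *+ p)) y) /\
              G i (site j *+ p) (act (- (site j *+ p)) y).
  have [y Ay] := indA q
    (fun w => if [pick j | site j == w] is Some j then F j else true).
  have [i Gi] := cG y; exists i, y => j; split; last exact: Gi.
  have := Ay _ (siteq j); case: pickP => [j' /eqP/site_inj->//|/(_ j)].
  by rewrite eqxx.
have [code codeE] := choice codeP.
have code_inj : injective code.
  move=> F F' FF'; apply/ffunP => j; have [y /(_ j)[Ay Gy]] := codeE F.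
  have [y' /(_ j)[Ay' Gy']] := codeE F'; rewrite -FF' in Gy'.
  have := sepU (UG (code F) _ (siteqp j)).
  case: (F j) Ay => Ay; case: (F' j) Ay' => // Ay' sep.
    by case: (sep _ _ Ay Ay').
  by case: (sep _ _ Ay' Ay).
by have := leq_card code code_inj; rewrite !card_ffun !card_ord card_bool.
Qed.

Lemma cover_entropy_independent : 0 < cover_entropy U.
Proof.
pose M n := min_subcover (join_cover U n).
have [y0 _] := indA 0 (fun=> true).
have M_gt0 n : 0 < (M n)%:R :> R.
  by rewrite ltr0n; apply: min_subcover_gt0.
have p0 : 0 < p%:R :> R by rewrite ltr0n.
have cvM : cvgn (fun n => ln (M n)%:R / n%:R ^+ d : R).
  apply: subadditive_cvg => [n|n m nm|q m m0].
  - by rewrite ln_ge0// ler1n -(ltr0n R).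
  - by rewrite ler_ln ?posrE// ler_nat min_subcover_cube_homo.
  rewrite -natrX mulr_natr -lnXn// ler_ln ?posrE ?exprn_gt0//.
  by rewrite -natrX ler_nat min_subcover_cubeM.
have ln2 : 0 < ln 2 :> R by rewrite ln_gt0// ltr1n.
(* The factor 2 absorbs rounding [n] down to a multiple of [p]. *)
apply: (@lt_le_trans _ _ (ln 2 / (2 * p%:R) ^+ d)).
  by rewrite divr_gt0// exprn_gt0// mulr_gt0.
apply: limr_ge cvM _; near=> n.
have pn : (p <= n)%N by near: n; exact: nbhs_infty_ge.
have n0 : 0 < n%:R :> R by rewrite ltr0n (leq_trans p_gt0).
have Mn : (2 ^ ((n %/ p) ^ d) <= M n)%N.
  apply: leq_trans (min_subcover_cube_homo finU (leq_trunc_div n p)).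
  exact/joint_subcover_independent/(min_subcover_spec finU _).1.
have := Mn; rewrite -(ler_nat R) -ler_ln ?posrE// ?ltr0n ?expn_gt0//.
rewrite natrX lnXn// -[X in X <= _ -> _]mulr_natr natrX => lnM.
rewrite ler_pdivlMr ?exprn_gt0//; apply: le_trans lnM.
rewrite -mulrA ler_wpM2l ?(ltW ln2)// -exprVn -exprMn.
apply: lerXn2r; rewrite ?nnegrE ?mulr_ge0 ?invr_ge0 ?mulr_ge0 ?ler0n//.
rewrite mulrC ler_pdivrMr ?mulr_gt0// -!natrM ler_nat.
have q_gt0 : (0 < n %/ p)%N by rewrite divn_gt0.
rewrite {1}(divn_eq n p) mulnCA mul2n -addnn.
by rewrite leq_add2l (leq_trans (ltnW (ltn_pmod n p_gt0)))// leq_pmull.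
Unshelve. all: by end_near.
Qed.

End Independence.

(** * Gluing blocks along a lattice *)

Lemma finite_box d (a b : Zd d) :
  finite_set [set s : Zd d | forall i, a i <= s i <= b i].
Proof.
pose N := (\max_(i < d) `|b i - a i|)%N.
pose h (f : {ffun 'I_d -> 'I_N.+1}) : Zd d := [ffun i => a i + (f i)%:Z].
apply: (@sub_finite_set _ _ (range h)); last first.
  exact/finite_image/finite_finset.
move=> s sab; have sN i : (`|s i - a i| < N.+1)%N.
  have : (`|b i - a i| <= N)%N := leq_bigmax i.
  by have := sab i; move: (s i) (a i) (b i) => x y z; lia.
exists [ffun i => Ordinal (sN i)] => //; apply/ffunP => i; rewrite !ffunE /=.
by have := sab i; move: (s i) (a i) => x y; lia.
Qed.

Lemma restriction_eqP d (A : finType) (x y : config d A) (S : {fset Zd d}) :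
  restriction x S = restriction y S -> forall s, s \in S -> x s = y s.
Proof.
move=> xy s sS; have := congr1 (fun w : {fmap Zd d -> A} => fnd w s) xy.
by rewrite /restriction !(in_fnd sS) !ffunE => -[].
Qed.

Lemma language_restriction d (A : finType) (X : subshift d A) x S :
  points X x -> language_on X S (restriction x S).
Proof.
move=> Xx; split=> //; exists x => //; exists 0.
by congr restriction; apply/funext => s; rewrite /Zshift addr0.
Qed.

(** Block gluing in terms of points rather than patterns; a gap along a single
axis [k] already separates the boxes in the sup norm. *)
Lemma block_gluing_boxes d (A : finType) (X : subshift d A) :
  block_gluing X -> exists g : nat, forall (a b a' b' : Zd d) (k : 'I_d),
    (forall i, a i <= b i) -> (forall i, a' i <= b' i) -> b k + g%:Z < a' k ->
    forall x x', points X x -> points X x' -> exists z, [/\ points X z,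
      forall s : Zd d, (forall i, a i <= s i <= b i) -> z s = x s &
      forall s : Zd d, (forall i, a' i <= s i <= b' i) -> z s = x' s].
Proof.
move=> [g glue]; exists g => a b a' b' k ab ab' gap x x' Xx Xx'.
pose box (a b : Zd d) := fset_set [set s : Zd d | forall i, a i <= s i <= b i].
have boxP (u v s : Zd d) : s \in box u v <-> forall i, u i <= s i <= v i.
  by rewrite in_fset_set ?inE//; exact: finite_box.
have is_box_box (u v : Zd d) : (forall i, u i <= v i) -> is_box (box u v).
  by move=> uv; exists u, v; split=> // s; apply/idP/forallP => /boxP.
have [|z [Xz zx zx']] := glue _ _ (is_box_box _ _ ab) (is_box_box _ _ ab') _ _ _
  (language_restriction (box a b) Xx) (language_restriction (box a' b') Xx').
  move=> s s' /boxP sab /boxP sab'; rewrite /supnorm.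
  apply: leq_trans (leq_bigmax k) => /=; rewrite !ffunE.
  have := sab k; have := sab' k; move: gap.
  by move: (s k) (s' k) (a k) (b k) (a' k) (b' k) => *; lia.
exists z; split=> // s /boxP sS; first exact: restriction_eqP zx s sS.
exact: restriction_eqP zx' s sS.
Qed.

(** By induction on the total side length of the box of lattice points: a box with
more than one point is cut along some axis [k] into the slice at [hi k] and the
rest.  The blocks indexed by either part lie in a box of [Z^d], and the choice
of [p] leaves a gap larger than the gluing constant between these two boxes. *)
Lemma lattice_gluing d (A : finType) (X : subshift d A) (r : nat) :
  block_gluing X -> exists2 p : nat, (0 < p)%N &
    forall f : Zd d -> config d A, (forall j, points X (f j)) ->
    forall lo hi : Zd d, (forall i, lo i <= hi i) ->
    exists2 x, points X x & forall j : Zd d, (forall i, lo i <= j i <= hi i) ->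
      forall s : Zd d, (forall i, `|s i| <= r%:Z) -> x (s + j *+ p) = f j s.
Proof.
move=> /block_gluing_boxes[g glue]; exists (r + r + g).+1 => // f Xf.
set p := (r + r + g).+1.
move=> lo hi; have [N] := ubnP (\sum_i `|hi i - lo i|)%N.
elim: N => // N IHN in lo hi *; rewrite ltnS => sumN lohi.
have [/forallP eq_lohi|] := boolP [forall i, lo i == hi i].
  exists (Zshift (- (lo *+ p)) (f lo)); first exact: points_shift.
  move=> j jlohi s _; have -> : j = lo.
    by apply/ffunP => i; apply/eqP; have := jlohi i;
       rewrite -(eqP (eq_lohi i)) eq_le andbC.
  by rewrite /Zshift addrK.
rewrite negb_forall => /existsP[k lohi_k].
pose mid : Zd d := [ffun i => if i == k then hi k - 1 else hi i].
pose mid' : Zd d := [ffun i => if i == k then hi k else lo i].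
have lomid i : lo i <= mid i.
  rewrite ffunE; case: eqP => [->|_]; last exact: lohi.
  by have := lohi k; move: lohi_k; move: (lo k) (hi k) => u v; lia.
have midhi i : mid' i <= hi i.
  by rewrite ffunE; case: eqP => [->|_] //; exact: lohi.
have [|x Xx xE] := IHN lo mid _ lomid.
  apply: leq_trans sumN; rewrite (bigD1 k)// [X in (_ < X)%N](bigD1 k)//=.
  rewrite -addSn leq_add//.
    rewrite ffunE eqxx; have := lohi k; move: lohi_k.
    by move: (lo k) (hi k) => u v; lia.
  by apply: leq_sum => i /negbTE ik; rewrite ffunE ik.
have [|x' Xx' xE'] := IHN mid' hi _ midhi.
  apply: leq_trans sumN; rewrite (bigD1 k)// [X in (_ < X)%N](bigD1 k)//=.
  rewrite -addSn leq_add//.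
    rewrite ffunE eqxx; have := lohi k; move: lohi_k.
    by move: (lo k) (hi k) => u v; lia.
  by apply: leq_sum => i /negbTE ik; rewrite ffunE ik.
pose low (l : Zd d) : Zd d := [ffun i => (l *+ p) i - r%:Z].
pose high (h : Zd d) : Zd d := [ffun i => (h *+ p) i + r%:Z].
have in_box (l h j s : Zd d) : (forall i, l i <= j i <= h i) ->
    (forall i, `|s i| <= r%:Z) ->
    forall i, low l i <= (s + j *+ p) i <= high h i.
  move=> jlh sr i; rewrite !ffunE !ffunMnE.
  have /andP[lj jh] := jlh i; have := sr i.
  have := ler_wMn2r p lj; have := ler_wMn2r p jh.
  by move: (l i *+ p) (h i *+ p) (j i *+ p) (s i) => *; lia.
have low_high (l h : Zd d) : (forall i, l i <= h i) ->
    forall i, low l i <= high h i.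
  move=> lh i; rewrite !ffunE !ffunMnE; have := ler_wMn2r p (lh i).
  by move: (l i *+ p) (h i *+ p) => *; lia.
have [|z [Xz zx zx']] := glue (low lo) (high mid) (low mid') (high hi) k
  (low_high _ _ lomid) (low_high _ _ midhi) _ x x' Xx Xx'.
  rewrite !ffunE !ffunMnE !ffunE eqxx mulrnBl natz /p.
  by move: (hi k *+ _) => *; lia.
exists z => // j jlohi s sr; case: (ltrP (j k) (hi k)) => jk.
  have jmid i : lo i <= j i <= mid i.
    rewrite ffunE; case: eqP => [->|_]; last exact: jlohi.
    by have := jlohi k; move: jk; move: (lo k) (hi k) (j k) => *; lia.
  by rewrite zx ?xE//; exact: in_box.
have jmid i : mid' i <= j i <= hi i.
  rewrite ffunE; case: eqP => [->|_]; last exact: jlohi.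
  by have := jlohi k; move: jk; move: (lo k) (hi k) (j k) => *; lia.
by rewrite zx' ?xE'//; exact: in_box.
Qed.

(** * Independence in the factors of a subshift *)

Lemma nbhs_cylinder d (A : finType) (X : subshift d A) (x : set_type X)
    (B : set (set_type X)) : nbhs x B ->
  exists r : nat, forall z : set_type X,
    (forall s : Zd d, (forall i, `|s i| <= r%:Z) ->
      set_val z s = set_val x s) ->
    B z.
Proof.
rewrite nbhsE => -[_ [[W oW <-] Wx] WB].
pose cyl (r : nat) : set (config d A) := [set y |
  forall s : Zd d, (forall i, `|s i| <= r%:Z) -> y s = set_val x s].
pose F := filter_from [set: nat] cyl.
have FF : Filter F.
  apply: filter_from_filter; first by exists 0%N.
  move=> m n _ _; exists (maxn m n) => // y ymn.
  by split=> s sr; apply: ymn => i; apply: le_trans (sr i) _;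
    rewrite lez_nat leq_max leqnn ?orbT.
suff Fx : F --> (set_val x : config d A).
  have [r _ rW] : F W by apply: Fx; exact: open_nbhs_nbhs.
  by exists r => z zx; apply: WB => /=; exact: rW.
change (F --> (set_val x : prod_topology (fun _ : Zd d => discrete_topology A))).
apply/cvg_sup => s C [V [[E oE <-] Ex VC]].
exists (supnorm s) => // y yx; apply: VC; move: Ex => /=.
rewrite -(yx s)// => i; rewrite -abszE lez_nat.
exact: (@leq_bigmax _ (fun i => `|s i|%N)).
Qed.

(** Neighbourhoods of two points of a factor pull back to sets containing
cylinders, and cylinders are independent by gluing.  One spacing serves both,
taken for the larger radius. *)
Lemma lattice_independent_factor (R : realType) d (A : finType)
    (X : subshift d A) (Y : system R d) (phi : subshift_system R X -> Y)
    (V : bool -> set Y) (x : bool -> subshift_system R X) :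
  block_gluing X -> factor_map phi -> (forall b, nbhs (phi (x b)) (V b)) ->
  exists2 p : nat, (0 < p)%N & lattice_independent V p.
Proof.
move=> glueX [phi_cont phi_act] nbhsV.
have [r rV] := choice (fun b => nbhs_cylinder (phi_cont (x b) (V b) (nbhsV b))).
have [p p0 glue] := lattice_gluing (maxn (r true) (r false)) glueX.
exists p => // n F.
(* The index is negated because independence is tested by [act (- (j *+ p))]. *)
have Xf (j : Zd d) : points X (set_val (x (F (- j)))) by exact: set_valP.
have lohi i : [ffun=> - n%:Z] i <= ([ffun=> n%:Z] : Zd d) i.
  by rewrite !ffunE; lia.
have [z Xz zE] := glue _ Xf _ _ lohi.
exists (phi (exist _ z (mem_set Xz))) => j nj.
rewrite -phi_act; apply: rV => s sr /=.
have := zE (- j) _ s; rewrite opprK mulNrn; apply.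
  by move=> i; have := nj i; rewrite !ffunE; move: (j i) => u; lia.
move=> i; apply: le_trans (sr i) _; rewrite lez_nat leq_max.
by case: (F j); rewrite leqnn ?orbT.
Qed.

(** Closed balls of radius a third of the distance.  Closed neighbourhoods are
wanted because their complements have to be open and to cover the space. *)
Lemma disjoint_closed_nbhs (R : realType) (Y : topologicalType) (y0 y1 : Y) :
  metrizable R Y -> y0 <> y1 -> exists V0 V1 : set Y,
    [/\ nbhs y0 V0, nbhs y1 V1, closed V0, closed V1 & V0 `&` V1 = set0].
Proof.
move=> [dist [dist_xx dist_eq0 distC dist_tri nbhsE]] y01.
have dist_ge0 x y : 0 <= dist x y.
  by have := dist_tri x y x; rewrite dist_xx (distC y x); lra.
have e0 : 0 < dist y0 y1.
  by rewrite lt_neqAle dist_ge0 andbT eq_sym; apply/eqP => /dist_eq0.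
set e := dist y0 y1 in e0.
have nbhs_ball y : nbhs y [set z | dist y z <= e / 3].
  rewrite nbhsE; exists (e / 3); first by rewrite /= divr_gt0.
  by move=> z /ltW.
have closed_ball y : closed [set z | dist y z <= e / 3].
  rewrite -openC openE => z /= /negP; rewrite -ltNge => yz.
  rewrite /interior nbhsE; exists (dist y z - e / 3).
    by rewrite /= subr_gt0.
  move=> w /= zw; apply/negP; rewrite -ltNge.
  by have := dist_tri y w z; rewrite (distC w z); lra.
exists [set z | dist y0 z <= e / 3], [set z | dist y1 z <= e / 3]; split=> //.
apply/seteqP; split=> // z [/= z0 z1].
by have := dist_tri y0 z y1; rewrite -/e (distC z y1); lra.
Qed.

Theorem corollary3p3 (R : realType) (d : nat) (A : finType) (X : subshift d A) :
  (1 <= d)%N -> SFT X -> block_gluing X -> nontrivial X ->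
  TCPE (subshift_system R X).
Proof.
move=> _ _ glueX _ Y phi phi_factor phi_surj.
have [Ytriv|Ynontriv] := pselect (exists y0 : Y, forall y, y = y0).
  by right.
have [x0 Xx0] := points_nonempty X.
pose y0 := phi (exist _ x0 (mem_set Xx0)).
have [y1 y01] : exists y1, y0 <> y1.
  apply: contrapT => noy1; apply: Ynontriv; exists y0 => y.
  by apply: contrapT => yy0; apply: noy1; exists y => /esym.
left.
have [V0 [V1 [nV0 nV1 clV0 clV1 V01]]] :=
  disjoint_closed_nbhs (@sys_metrizable _ _ Y) y01.
have [x1 x1E] := phi_surj y1.
pose x b := if b then x1 else exist _ x0 (mem_set Xx0).
pose V b := if b then V1 else V0.
have [|p p0 indV] :=
  @lattice_independent_factor R d A X Y phi V x glueX phi_factor.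
  by case; rewrite /V /x ?x1E.
pose U := [set ~` V0; ~` V1].
have coverU : \bigcup_(B in U) B = setT.
  by rewrite bigcup_setU1 bigcup_set1 -setCI V01 setC0.
have openU : open_cover U.
  by split=> // B [] ->; rewrite openC.
have finU : exists k, has_subcover_of_card U k.
  have /finite_setP[k Uk] : finite_set U by exact: finite_set2.
  by exists k, U; split=> //.
have sepU B y z : U B -> V true y -> V false z -> ~ (B y /\ B z).
  by case=> -> Vy Vz [nVy nVz]; [exact: nVz|exact: nVy].
apply: lt_le_trans (ereal_sup_ubound _); last by exists U.
by rewrite lte_fin; exact: cover_entropy_independent p0 indV sepU finU.
Qed.
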